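(* Let $p, q \in (1,\infty)$ and, for $m\in(1,\infty)$, let $$I_{p,q}(m)=m^{1/q}\int_0^\infty \left|\frac{\sin_{p,q}x}{x}\right|^m dx.$$ Then $$\lim_{m \to \infty} I_{p,q}(m)=\frac{1}{q}\,\Gamma \left(\frac{1}{q}\right)(p(q+1))^{1/q}.$$
   Context: For $p,q\in(1,\infty)$ let $F_{p,q}(x)=\int_0^x (1-t^q)^{-1/p}\,dt$ for $x\in[0,1]$, and let $\pi_{p,q}:=2F_{p,q}(1)$. The generalised sine function $\sin_{p,q}:[0,\pi_{p,q}/2]\to[0,1]$ is the inverse of $F_{p,q}:[0,1]\to[0,\pi_{p,q}/2]$. It is extended to all of $\mathbb{R}$ as a $2\pi_{p,q}$-periodic function by $\sin_{p,q}x=\sin_{p,q}(\pi_{p,q}-x)$ and $\sin_{p,q}(-x)=-\sin_{p,q}x$. The function $(\sin_{p,q}x)/x$ is given the value $1$ at $x=0$. $\Gamma$ is the gamma function, and $m$ ranges over real numbers. *)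

(* Defs.v *)
From HB Require Import structures.
From mathcomp Require Import all_boot all_order all_algebra.
From mathcomp Require Import all_classical all_reals all_analysis.
Import Order.TTheory GRing.Theory Num.Theory.
Import numFieldNormedType.Exports.

Set Implicit Arguments.
Unset Strict Implicit.
Unset Printing Implicit Defensive.

Local Open Scope classical_set_scope.
Local Open Scope ring_scope.

(* At t = 1 the integrand is 0 `^ (- p^-1) = 0 by convention; a null set. *)
Definition Fpq (R : realType) (p q : R) (x : R) : R :=
  (\int[@lebesgue_measure R]_(t in `[0, x]) ((1 - t `^ q) `^ (- p^-1)))%R.

Definition pi_pq (R : realType) (p q : R) : R := 2 * Fpq p q 1.

(* Meaningful on [0, pi_pq / 2], the image of [0, 1] under Fpq. *)
Definition sin_pq_base (R : realType) (p q : R) : R -> R :=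
  'pinv_(fun=> 0) `[0, 1] (Fpq p q).

(* The extension to [0, pi_pq] by reflection. *)
Definition sin_pq_half (R : realType) (p q : R) (x : R) : R :=
  if x <= pi_pq p q / 2 then sin_pq_base p q x
  else sin_pq_base p q (pi_pq p q - x).

(* The representative of x modulo 2 pi_pq in [- pi_pq, pi_pq). *)
Definition reduce_pq (R : realType) (p q : R) (x : R) : R :=
  x - (Num.floor ((x + pi_pq p q) / (2 * pi_pq p q)))%:~R * (2 * pi_pq p q).

Definition sin_pq (R : realType) (p q : R) (x : R) : R :=
  let y := reduce_pq p q x in
  if 0 <= y then sin_pq_half p q y else - sin_pq_half p q (- y).

Definition sinc_pq (R : realType) (p q : R) (x : R) : R :=
  if x == 0 then 1 else sin_pq p q x / x.

Definition Gamma (R : realType) (s : R) : R :=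
  (\int[@lebesgue_measure R]_(t in `]0, +oo[) (t `^ (s - 1) * expR (- t)))%R.

(* Extended-real valued, so that a divergent integral is +oo. *)
Definition Ipq (R : realType) (p q m : R) : \bar R :=
  ((m `^ q^-1)%:E *
   \int[@lebesgue_measure R]_(x in `[0%R, +oo[) (`|sinc_pq p q x| `^ m)%:E)%E.

(* Main.v *)
Require Import Defs.
From HB Require Import structures.
From mathcomp Require Import all_boot all_order all_algebra.
From mathcomp Require Import all_classical all_reals all_analysis.
From mathcomp Require Import measurable_realfun ring lra.
Import Order.TTheory GRing.Theory Num.Theory.
Import numFieldNormedType.Exports.
Local Open Scope classical_set_scope.
Local Open Scope ring_scope.

(** Put c = p (q + 1), u(x) = |sinc_pq x| and K = q^-1 Gamma(q^-1).  Since
    (1 - t^q)^(-1/p) = 1 + t^q / p + ..., the incomplete integral F = Fpq satisfies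
    F(s) = s + s^(q+1) / c + ..., so that u(x) is close to exp(- x^q / c) near
    0.  Raising to the power m and rescaling x by m^(-1/q), the integral of
    exp(- m x^q / c) contributes m^(-1/q) c^(1/q) K, and everything away from 0
    decays exponentially in m.

    To make this precise, u is squeezed between explicit functions, through
    inequalities on F alone.  Inequality F(s) >= s (1 + s^q / c)
    bounds S = |sin_pq x| by S (1 + S^q / c) <= x for every x >= 0
    (sin_pq_controlled): this survives reflection and reduction modulo the
    period because both only decrease the argument, and it also holds where
    the inverse takes its default value 0.  Since v <= exp (v - 1), it follows
    that for every 0 < r < 1 either u <= r or u <= exp (- r^(q+1) x^q / c)
    (sinc_pq_dichotomy).  Conversely, F(s) <= s (1 + A s^q / c) for s small,
    with A > 1 as close to 1 as desired, gives u >= exp (- A x^q / c) near 0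
    (sinc_pq_ge).

    Both exponentials integrate exactly, by the substitution t = B x^q
    (integral_expRN_powR).  Integrating m-th powers yields, for each l in
    ]0, 1[, bounds l L - o(1) <= Ipq m <= L / l + o(1), where L = c^(1/q) K
    (near_Ipq_ge, near_Ipq_le), and letting l tend to 1 concludes.

    The integral of u^m is compared with explicit ones through monotonicity
    alone, which holds for arbitrary nonnegative functions
    (ge0_le_integral_nonmeasurable). *)

(** * Monotonicity of the integral, and values of a partial inverse *)

(** The integral of a nonnegative function is a supremum over the simple
    functions below it, hence monotone on arbitrary nonnegative functions. *)
Lemma ge0_le_integral_nonmeasurable (d : measure_display)
    (T : measurableType d) (R : realType) (mu : {measure set T -> \bar R})
    (D : set T) (f g : T -> \bar R) :
  (forall x, D x -> 0 <= f x)%E -> (forall x, D x -> f x <= g x)%E ->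
  (\int[mu]_(x in D) f x <= \int[mu]_(x in D) g x)%E.
Proof.
move=> f0 fg.
have g0 x : D x -> (0 <= g x)%E.
  by move=> Dx; exact: le_trans (f0 _ Dx) (fg _ Dx).
rewrite !ge0_integralE//; apply: ge_ereal_sup => _ [h /= hf <-].
apply: ereal_sup_ubound; exists h => //= x.
apply: le_trans (hf x) _; rewrite /patch; case: ifPn => // /set_mem.
exact: fg.
Qed.

Lemma pinv_spec (T U : Type) (dflt : U -> T) (A : set T) (f : T -> U) (y : U) :
  (A ('pinv_dflt A f y) /\ f ('pinv_dflt A f y) = y) \/
  ('pinv_dflt A f y = dflt y /\ ~ (f @` A) y).
Proof.
have [Ay|nAy] := pselect ((f @` A) y).
  left; split; last by rewrite pinvK ?inE.
  by rewrite /pinv_ splitV; case: oinvP.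
right; split => //; rewrite /pinv_ splitV.
by rewrite /= oinv_surj; case: pselect.
Qed.

(** * Elementary bounds on (1 - y)^(-1/p) *)

Section elementary.
Context {R : realType}.
Implicit Types p q t y m : R.

(** From ln (1 - y) <= - y and 1 + z <= exp z. *)
Lemma powR_onem_ge p y : 0 < p -> 0 <= y < 1 ->
  1 + y / p <= (1 - y) `^ (- p^-1).
Proof.
move=> p0 /andP[y0 y1]; rewrite /powR gt_eqF ?subr_gt0//.
apply: le_trans (expR_ge1Dx _) _; rewrite ler_expR mulNr -mulrN mulrC.
rewrite ler_pM2l ?invr_gt0// lerNr; apply: le_ln1Dx; lra.
Qed.

(** From - ln (1 - y) <= y / (1 - y) and exp w <= (1 - w)^-1; the denominator
    1 - 2 r absorbs the product of the two losses, and tends to 1 with r. *)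
Lemma powR_onem_le p r y : 1 < p -> 2 * r < 1 -> 0 <= y <= r ->
  (1 - y) `^ (- p^-1) <= 1 + y / p / (1 - 2 * r).
Proof.
move=> p1 r1 /andP[y0 yr]; have p0 : 0 < p by lra.
set z := y / p; set w := z / (1 - r).
have z0 : 0 <= z by rewrite divr_ge0// ltW.
have zr : z <= r by rewrite /z ler_pdivrMr//; nra.
have w1 : w < 1 by rewrite /w ltr_pdivrMr; lra.
have w0 : 0 <= w by rewrite divr_ge0//; lra.
apply: (@le_trans _ _ (expR w)).
  rewrite /powR gt_eqF; last by lra.
  have y1 : 0 < 1 - y by lra.
  have -> : - p^-1 * ln (1 - y) = p^-1 * ln (1 - y)^-1.
    by rewrite lnV ?posrE// mulrN mulNr.
  have -> : w = p^-1 * (y / (1 - r)) by rewrite /w /z mulrCA mulrA.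
  rewrite ler_expR ler_pM2l ?invr_gt0//.
  have -> : (1 - y)^-1 = 1 + y / (1 - y) by field; lra.
  apply: le_trans (le_ln1Dx _) _.
    by apply: (@lt_le_trans _ _ 0); [lra|rewrite divr_ge0//; lra].
  by rewrite ler_wpM2l// lef_pV2 ?posrE; lra.
apply: (@le_trans _ _ (1 - w)^-1).
  rewrite -[expR w]invrK -expRN lef_pV2 ?posrE ?expR_gt0//; last by lra.
  exact: expR_ge1Dx.
rewrite -[leLHS]div1r ler_pdivrMr; last by lra.
have -> : (1 + z / (1 - 2 * r)) * (1 - w) =
  1 + z * (r - z) / ((1 - r) * (1 - 2 * r)) by rewrite /w; field; lra.
by rewrite lerDl; apply: divr_ge0; apply: mulr_ge0; lra.
Qed.
End elementary.

(** * The incomplete integral Fpq *)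

Section Fpq_integrand.
Context {R : realType}.
Notation mu := (@lebesgue_measure R).
Implicit Types p q t x s k : R.

Lemma continuous_powR_gt0 q x : 0 < x -> {for x, continuous (@powR R ^~ q)}.
Proof.
move=> x0; apply/differentiable_continuous/derivable1_diffP.
by apply: derivable_powR; rewrite in_itv/= andbT.
Qed.

Lemma cvg_powR_right0 q : 0 < q -> (@powR R ^~ q) t @[t --> 0^'+] --> (0:R) `^ q.
Proof. by move=> q0; rewrite powR0 ?gt_eqF//; exact: powR_cvg0. Qed.

Lemma is_derive_powR_onem (a t : R) : t < 1 -> a != 0 ->
  is_derive t 1 (fun t => - (a^-1 * (1 - t) `^ a)) ((1 - t) `^ (a - 1)).
Proof.
move=> t1 a0.
have d1 : is_derive (t : R^o) 1 (fun t => 1 - t) (-1).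
  by apply: is_derive_eq; rewrite add0r mul1r.
have d2 : is_derive (1 - t) 1 (@powR R ^~ a) (a * (1 - t) `^ (a - 1)).
  by apply: is_derive1_powR; rewrite subr_gt0.
have d3 := @is_derive1_comp _ (@powR R ^~ a) (fun t => 1 - t) t _ _ d2 d1.
have -> : (fun t => - (a^-1 * (1 - t) `^ a)) =
   (- (a^-1 \*: ((@powR R ^~ a) \o (fun t => 1 - t)))).
  by apply/funext => y.
apply: is_derive_eq.
by rewrite /GRing.scale/=; field.
Qed.

(** The integrand may be singular at 1, so the fundamental theorem of calculus
    is applied on [0, 1 - 1 / (n + 2)], where it gives the bound a^-1, and
    monotone convergence carries the bound to [0, 1[. *)
Lemma integral_powR_onem_lty (a : R) : 0 < a ->
  (\int[mu]_(t in `[0%R, 1%R]) ((1 - t) `^ (a - 1))%:E < +oo)%E.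
Proof.
move=> a0.
have mf : measurable_fun [set: R] (EFin \o (fun t : R => (1 - t) `^ (a - 1))).
  apply/measurable_EFinP; apply: (measurableT_comp (measurable_powR _)).
  exact: measurable_funB.
pose b (n : nat) : R := 1 - n.+2%:R^-1.
have b0 n : 0 < b n by rewrite /b subr_gt0 invf_lt1// ltr1n.
have b1 n : b n < 1 by rewrite /b ltrBlDr ltrDl invr_gt0.
rewrite -integral_itv_bndo_bndc; last exact: measurable_funTS.
have -> : `[0, 1[%classic = \bigcup_n `[0, b n]%classic :> set R.
  apply/seteqP; split => [x /=|x [n _ /=]]; rewrite !in_itv/= => /andP[x0 x1].
    have [n _ nx] := near_infty_natSinv_lt (PosNum (etrans (subr_gt0 x 1) x1)).
    exists n => //=; rewrite in_itv/= x0/= /b lerBrDr -lerBrDl.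
    by apply/ltW/(nx n.+1) => /=.
  by rewrite x0/= (le_lt_trans x1).
pose I n := (\int[mu]_(t in `[0%R, b n]) ((1 - t) `^ (a - 1))%:E)%E.
have Ile n : (I n <= (a^-1)%:E)%E.
  rewrite /I (@continuous_FTC2 _ _ (fun t => - (a^-1 * (1 - t) `^ a)))//.
  - rewrite -EFinB lee_fin subr0 powR1 mulr1 opprK gerDr oppr_le0.
    by rewrite mulr_ge0 ?powR_ge0// invr_ge0 ltW.
  - apply: continuous_in_subspaceT => x /[!inE]/=; rewrite in_itv/= => /andP[_ xb].
    apply: (@continuous_comp _ _ _ (fun t : R => 1 - t) (@powR R ^~ (a - 1))); first by apply: cvgB; [exact: cvg_cst|exact: cvg_id].
    by apply: continuous_powR_gt0; rewrite subr_gt0 (le_lt_trans xb).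
  - have cF x : x < 1 -> {for x, continuous (fun t => - (a^-1 * (1 - t) `^ a))}.
      move=> x1; apply/differentiable_continuous/derivable1_diffP.
      by have [] := is_derive_powR_onem a x x1 (lt0r_neq0 a0).
    split.
    + move=> x; rewrite in_itv/= => /andP[_ xb].
      have x1 : x < 1 by exact: lt_trans xb _.
      by have [] := is_derive_powR_onem a x x1 (lt0r_neq0 a0).
    + by apply: cvg_at_right_filter; exact: cF.
    + by apply: cvg_at_left_filter; exact: cF.
  - move=> x; rewrite in_itv/= => /andP[_ xb].
    have x1 : x < 1 by exact: lt_trans xb _.
    have d := is_derive_powR_onem a x x1 (lt0r_neq0 a0).
    by rewrite derive1E derive_val.
apply: (@le_lt_trans _ _ (a^-1)%:E); last exact: ltry.
have h : (I n @[n --> \oo] --> \int[mu]_(t in \bigcup_n `[0%R, b n]%classic)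
    ((1 - t) `^ (a - 1))%:E)%E.
  apply: ge0_nondecreasing_set_cvg_integral.
  - move=> m n mn; apply/subsetPset; apply: subset_itvl; rewrite bnd_simp /b.
    by rewrite lerD2l lerN2 lef_pV2 ?posrE// ler_nat.
  - by [].
  - by move=> i; exact: measurable_funTS.
  - by move=> i x _; rewrite lee_fin powR_ge0.
rewrite -(cvg_lim _ h)//; apply: lime_le; first exact: (cvgP _ h).
by apply: nearW.
Qed.

(** Since q > 1, t^q <= t; this reduces integrability to a pure power of
    1 - t. *)
Lemma Fpq_integrand_le p q t : 1 < p -> 1 < q -> 0 <= t <= 1 ->
  (1 - t `^ q) `^ (- p^-1) <= (1 - t) `^ (- p^-1).
Proof.
move=> p1 q1 /andP[]; rewrite le_eqVlt => /predU1P[<- _|t0].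
  by rewrite powR0 ?subr0// gt_eqF//; lra.
rewrite le_eqVlt => /predU1P[->|t1]; first by rewrite powR1.
have tq : t `^ q <= t by rewrite ge1r_powR ?t0 ?ltW.
rewrite !powRN lef_pV2 ?posrE ?powR_gt0//; [|lra..].
apply: ge0_ler_powR; rewrite ?invr_ge0 ?nnegrE//; lra.
Qed.

Lemma measurable_Fpq_integrand p q :
  measurable_fun [set: R] (fun t : R => (1 - t `^ q) `^ (- p^-1)).
Proof.
apply: (measurableT_comp (measurable_powR _)).
by apply: measurable_funB => //; exact: measurable_powR.
Qed.

Lemma integrable_Fpq_integrand p q s : 1 < p -> 1 < q -> s <= 1 ->
  mu.-integrable `[0, s] (EFin \o (fun t : R => (1 - t `^ q) `^ (- p^-1))).
Proof.
move=> p1 q1 s1; apply: (@integrableS _ _ _ mu `[0, 1]) => //.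
  by apply: subset_itvl; rewrite bnd_simp.
apply/integrableP; split.
  by apply/measurable_EFinP/measurable_funTS; exact: measurable_Fpq_integrand.
apply: le_lt_trans (@integral_powR_onem_lty (1 - p^-1) _); last first.
  by rewrite subr_gt0 invf_lt1//; lra.
apply: ge0_le_integral_nonmeasurable => t; first by rewrite abse_ge0.
rewrite /= in_itv/= => t01; rewrite lee_fin ger0_norm ?powR_ge0//.
rewrite (_ : 1 - p^-1 - 1 = - p^-1); last by lra.
exact: Fpq_integrand_le.
Qed.

Lemma within_continuous_powR q s : 0 < q -> 0 < s ->
  {within `[0, s], continuous (@powR R ^~ q)}.
Proof.
move=> q0 s0; apply/continuous_within_itvP => //; split.
- by move=> x; rewrite in_itv/= => /andP[x0 _]; exact: continuous_powR_gt0.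
- exact: cvg_powR_right0.
- by apply: cvg_at_left_filter; exact: continuous_powR_gt0.
Qed.

Lemma integrable_1DpowR k q s : 0 < q -> 0 < s ->
  mu.-integrable `[0, s] (EFin \o (fun t : R => 1 + k * t `^ q)).
Proof.
move=> q0 s0; apply: continuous_compact_integrable; first exact: segment_compact.
move=> x; apply: cvgD; first exact: cvg_cst.
by apply: cvgM; [exact: cvg_cst|exact: within_continuous_powR].
Qed.

Lemma Rintegral_1DpowR k q s : 0 < q -> 0 < s ->
  (\int[mu]_(t in `[0, s]) (1 + k * t `^ q))%R =
    s + k / (q + 1) * s `^ (q + 1).
Proof.
move=> q0 s0; have q10 : 0 < q + 1 by lra.
have dG x : 0 < x -> is_derive x 1 (fun t => t + k / (q + 1) * t `^ (q + 1))
    (1 + k * x `^ q).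
  move=> x0; have dx := is_derive1_powR (q + 1) x0.
  have -> : (fun t => t + k / (q + 1) * t `^ (q + 1)) =
     (id : R -> R) + ((k / (q + 1)) \*: (@powR R ^~ (q + 1))) by apply/funext.
  apply: is_derive_eq; rewrite addrK /GRing.scale/=; field; lra.
have cG x : 0 < x -> {for x, continuous (fun t => t + k / (q + 1) * t `^ (q + 1))}.
  move=> x0; apply/differentiable_continuous/derivable1_diffP.
  by have [] := dG _ x0.
rewrite /Rintegral (@continuous_FTC2 _ _ (fun t => t + k / (q + 1) * t `^ (q + 1)))//.
- by rewrite powR0 ?mulr0 ?addr0 ?sube0// gt_eqF.
- move=> x; apply: cvgD; first exact: cvg_cst.
  by apply: cvgM; [exact: cvg_cst|exact: within_continuous_powR].
- split.
  + by move=> x; rewrite in_itv/= => /andP[x0 _]; have [] := dG _ x0.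
  + apply: cvgD; first by apply: cvg_at_right_filter; exact: cvg_id.
    by apply: cvgM; [exact: cvg_cst|exact: cvg_powR_right0].
  + by apply: cvg_at_left_filter; exact: cG.
- move=> x; rewrite in_itv/= => /andP[x0 _]; have d := dG _ x0.
  by rewrite derive1E derive_val.
Qed.

Lemma Fpq0 p q : Fpq p q 0 = 0 :> R.
Proof. by rewrite /Fpq set_itv1 Rintegral_set1. Qed.

(** Integrate 1 + t^q / p <= (1 - t^q)^(-1/p). *)
Lemma Fpq_ge p q s : 1 < p -> 1 < q -> 0 <= s <= 1 ->
  s * (1 + s `^ q / (p * (q + 1))) <= Fpq p q s.
Proof.
move=> p1 q1 /andP[]; rewrite le_eqVlt => /predU1P[<- _|s0 s1].
  by rewrite Fpq0 mul0r.
have -> : s * (1 + s `^ q / (p * (q + 1))) =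
    (\int[mu]_(t in `[0, s]) (1 + p^-1 * t `^ q))%R.
  rewrite Rintegral_1DpowR//; last by lra.
  rewrite powRD ?powRr1 ?ltW//; last by rewrite gt_eqF//; lra.
  by field; lra.
have i1 := integrable_1DpowR p^-1 q s (lt_trans ltr01 q1) s0.
have i2 := integrable_Fpq_integrand p q s p1 q1 s1.
(* At t = s = 1 the integrand is 0 and the pointwise bound fails: drop the
   endpoint. *)
have sub : `[0, s[%classic `<=` (`[0, s]%classic : set R).
  by apply: subset_itvl; rewrite bnd_simp.
have {}i1 : mu.-integrable `[0, s[ (EFin \o (fun t : R => 1 + p^-1 * t `^ q)).
  by apply: (@integrableS _ _ _ mu `[0, s]) => //; exact: sub.
have {}i2 : mu.-integrable `[0, s[
    (EFin \o (fun t : R => (1 - t `^ q) `^ (- p^-1))).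
  by apply: (@integrableS _ _ _ mu `[0, s]) => //; exact: sub.
rewrite /Fpq -!Rintegral_itv_bndo_bndc//; apply: le_Rintegral => //.
move=> t /=; rewrite in_itv/= => /andP[t0 ts].
rewrite mulrC; apply: powR_onem_ge; first lra.
rewrite powR_ge0/=; have [->|t0'] := eqVneq t 0.
  by rewrite powR0 ?ltr01// gt_eqF//; lra.
have : t `^ q < (1 : R) `^ q.
  by apply: gt0_ltr_powR; rewrite ?nnegrE//; lra.
by rewrite powR1.
Qed.

Lemma Fpq_le p q r s : 1 < p -> 1 < q -> 2 * r < 1 ->
  0 <= s <= 1 -> s `^ q <= r ->
  Fpq p q s <= s * (1 + s `^ q / (p * (q + 1)) / (1 - 2 * r)).
Proof.
move=> p1 q1 r1 /andP[]; rewrite le_eqVlt => /predU1P[<- _ _|s0 s1 sr].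
  by rewrite Fpq0 mul0r.
have -> : s * (1 + s `^ q / (p * (q + 1)) / (1 - 2 * r)) =
    (\int[mu]_(t in `[0, s]) (1 + (p^-1 / (1 - 2 * r)) * t `^ q))%R.
  rewrite Rintegral_1DpowR//; last by lra.
  rewrite powRD ?powRr1 ?ltW//; last by rewrite gt_eqF//; lra.
  by field; lra.
apply: le_Rintegral => //.
- exact: integrable_Fpq_integrand.
- by apply: integrable_1DpowR => //; lra.
- move=> t /=; rewrite in_itv/= => /andP[t0 ts].
  rewrite mulrC mulrA; apply: powR_onem_le => //.
  rewrite powR_ge0/=; apply: le_trans sr.
  by apply: ge0_ler_powR; rewrite ?nnegrE//; lra.
Qed.

(** Intermediate values, as Fpq is continuous with Fpq 0 = 0 and
    1 <= Fpq 1. *)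
Lemma Fpq_surj p q x : 1 < p -> 1 < q -> 0 <= x <= 1 ->
  (Fpq p q @` `[0, 1]) x.
Proof.
move=> p1 q1 /andP[x0 x1].
have := @IVT R (Fpq p q) 0 1 x ler01.
have F1 : 1 <= Fpq p q 1 :> R.
  apply: le_trans (Fpq_ge _ _ 1 p1 q1 _); last by rewrite ler01 lexx.
  by rewrite powR1 mul1r lerDl divr_ge0// mulr_ge0//; lra.
case.
- apply: parameterized_integral_continuous => //.
  exact: integrable_Fpq_integrand.
- rewrite Fpq0 ge_min x0/= le_max; apply/orP; right; exact: le_trans F1.
- by move=> s s01 <-; exists s.
Qed.

End Fpq_integrand.

(** * Bounds on the generalised sine *)

Section sin_pq_bounds.
Context {R : realType}.
Variables p q : R.
Implicit Types x y r : R.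

Lemma pi_pq_ge2 : 1 < p -> 1 < q -> 2 <= pi_pq p q.
Proof.
move=> p1 q1.
rewrite /pi_pq ler_peMr//.
apply: le_trans (Fpq_ge p q 1 p1 q1 _); last by rewrite ler01 lexx.
by rewrite powR1 mul1r lerDl divr_ge0// mulr_ge0//; lra.
Qed.

(** The form in which the upper bound on the sine is carried around: a relation
    between a value s and a point y, monotone in y, hence stable under the
    extension of the sine from the base interval. *)
Definition sin_controlled (s y : R) :=
  0 <= s <= 1 /\ s * (1 + s `^ q / (p * (q + 1))) <= y.

Lemma sin_controlled_le s y : 1 < p -> 1 < q -> sin_controlled s y -> s <= y.
Proof.
move=> p1 q1.
move=> [/andP[s0 _]]; apply: le_trans; rewrite ler_peMr// lerDl.
by rewrite divr_ge0 ?powR_ge0// mulr_ge0//; lra.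
Qed.

(** Either y = Fpq s, and the bound is Fpq_ge, or y is not a value of Fpq and
    the inverse is 0 there. *)
Lemma sin_pq_base_controlled y : 1 < p -> 1 < q -> sin_controlled (sin_pq_base p q y) `|y|.
Proof.
move=> p1 q1.
rewrite /sin_pq_base; set s := 'pinv_(_) _ _ _.
have [[]|[]] := pinv_spec _ _ (fun=> 0) `[0, 1]%classic (Fpq p q) y.
- rewrite -/s /= in_itv/= => s01 Fs; split => //.
  by apply: le_trans (ler_norm y); rewrite -Fs; exact: Fpq_ge.
- by rewrite -/s => -> _; split; rewrite ?lexx ?ler01// mul0r.
Qed.

Lemma sin_controlledW s y z : y <= z -> sin_controlled s y -> sin_controlled s z.
Proof. by move=> yz [s01 sy]; split => //; exact: le_trans yz. Qed.

Lemma sin_pq_half_controlled y : 1 < p -> 1 < q -> 0 <= y -> sin_controlled (sin_pq_half p q y) y.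
Proof.
move=> p1 q1.
move=> y0; have pi2 := pi_pq_ge2 p1 q1; rewrite /sin_pq_half; case: ifPn => hy.
  by rewrite -{2}(ger0_norm y0); exact: sin_pq_base_controlled.
apply: (@sin_controlledW _ `|pi_pq p q - y|); last exact: sin_pq_base_controlled.
by rewrite -ltNge in hy; rewrite ler_norml; lra.
Qed.

(** For 0 <= x < pi_pq nothing is subtracted; otherwise the reduced point lies
    in [- pi_pq, pi_pq) and pi_pq <= x. *)
Lemma reduce_pq_le x : 1 < p -> 1 < q -> 0 <= x -> `|reduce_pq p q x| <= x.
Proof.
move=> p1 q1.
move=> x0; have pi2 := pi_pq_ge2 p1 q1; rewrite /reduce_pq.
set P := pi_pq p q in pi2 *; set k := Num.floor _.
have P0 : 0 < 2 * P by lra.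
have /andP[] := floor_itv ((x + P) / (2 * P)); rewrite -/k.
rewrite intrD mulr1z ler_pdivlMr// ltr_pdivrMr// mulrDl mul1r => kx xk.
have k0 : 0 <= k by rewrite -[k]/(Num.floor _) floor_ge0 divr_ge0//; lra.
have [k1|k1] := leP 1 k.
  have : (1 : R) <= k%:~R by rewrite (ler_int _ 1).
  by rewrite ler_norml; nra.
have -> : k = 0 by apply/eqP; rewrite eq_le k0 andbT -ltzD1.
by rewrite mul0r subr0 ger0_norm.
Qed.

Lemma sin_pq_controlled x : 1 < p -> 1 < q -> 0 <= x -> sin_controlled `|sin_pq p q x| x.
Proof.
move=> p1 q1.
move=> x0; apply: (sin_controlledW _ _ _ (reduce_pq_le _ p1 q1 x0)).
rewrite /sin_pq; case: ifPn => y0; rewrite ?normrN; last first.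
  rewrite -ltNge in y0; rewrite -[`|reduce_pq p q x|]ger0_norm// [`|reduce_pq p q x|]ltr0_norm//.
  have := sin_pq_half_controlled (- reduce_pq p q x) p1 q1; rewrite oppr_ge0 => /(_ (ltW y0)) h.
  rewrite [`| - _|]ger0_norm ?oppr_ge0 ?ltW// ger0_norm//.
  by case: h => /andP[].
rewrite [`|reduce_pq p q x|]ger0_norm//.
have h := sin_pq_half_controlled _ p1 q1 y0.
by rewrite ger0_norm//; case: h => /andP[].
Qed.

Lemma Fpq_sin_pq x : 1 < p -> 1 < q -> 0 <= x <= 1 -> 0 <= sin_pq p q x /\ Fpq p q (sin_pq p q x) = x.
Proof.
move=> p1 q1.
move=> /andP[x0 x1]; have pi2 := pi_pq_ge2 p1 q1.
have rx : reduce_pq p q x = x.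
  rewrite /reduce_pq (_ : Num.floor _ = 0) ?mul0r ?subr0//.
  apply/eqP; rewrite floor_eq add0r mulr1z mulr0z; rewrite ler_pdivlMr ?ltr_pdivrMr; lra.
rewrite /sin_pq rx x0 /sin_pq_half ifT; last by lra.
split; first by have [/andP[]] := sin_pq_base_controlled x p1 q1.
rewrite /sin_pq_base pinvK// inE; apply: Fpq_surj => //; lra.
Qed.

Lemma sinc_pq_gt0E x : 0 < x -> `|sinc_pq p q x| * x = `|sin_pq p q x|.
Proof.
move=> x0; rewrite /sinc_pq gt_eqF// normrM normfV (gtr0_norm x0).
by rewrite divfK// gt_eqF.
Qed.

Lemma sinc_pq_le1 x : 1 < p -> 1 < q -> 0 <= x -> `|sinc_pq p q x| <= 1.
Proof.
move=> p1 q1.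
rewrite le_eqVlt => /predU1P[<-|x0]; first by rewrite /sinc_pq eqxx normr1.
have := sin_controlled_le _ _ p1 q1 (sin_pq_controlled _ p1 q1 (ltW x0)).
by rewrite -sinc_pq_gt0E// -[leRHS]mul1r ler_pM2r.
Qed.

Lemma sinc_pq_mul_le1 x : 1 < p -> 1 < q -> 0 <= x -> `|sinc_pq p q x| * x <= 1.
Proof.
move=> p1 q1.
rewrite le_eqVlt => /predU1P[<-|x0]; first by rewrite mulr0.
by rewrite sinc_pq_gt0E//; have [/andP[]] := sin_pq_controlled _ p1 q1 (ltW x0).
Qed.

(** With S = u x, the control on the sine reads u (1 + u^q x^q / c) <= 1, that
    is u^(q+1) x^q / c <= 1 - u.  If u > r this gives
    u <= exp (- (1 - u)) <= exp (- r^(q+1) x^q / c). *)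
Lemma sinc_pq_dichotomy r x : 1 < p -> 1 < q -> 0 < r -> 0 <= x ->
  `|sinc_pq p q x| <= r \/
  `|sinc_pq p q x| <= expR (- (r `^ (q + 1) / (p * (q + 1)) * x `^ q)).
Proof.
move=> p1 q1.
move=> r0; rewrite le_eqVlt => /predU1P[<-|x0].
  by right; rewrite powR0 ?mulr0 ?oppr0 ?expR0 ?sinc_pq_le1// gt_eqF//; lra.
have [ur|ur] := leP `|sinc_pq p q x| r; [by left|right].
have c0 : 0 < p * (q + 1) by rewrite mulr_gt0//; lra.
have [_] := sin_pq_controlled _ p1 q1 (ltW x0); rewrite -sinc_pq_gt0E//.
set u := `|sinc_pq p q x| in ur *; set c := p * (q + 1) in c0 *.
have u0 : 0 < u by exact: lt_trans ur.
move=> h; have {}h : u * (1 + (u * x) `^ q / c) <= 1.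
  by rewrite -(ler_pM2r x0) mul1r mulrAC.
rewrite (powRM _ (ltW u0) (ltW x0)) in h.
have uq : u * u `^ q = u `^ (q + 1).
  by rewrite addrC powRD ?powRr1 ?ltW// gt_eqF//; lra.
have h' : u `^ (q + 1) / c * x `^ q <= 1 - u.
  rewrite -uq; have -> : u * u `^ q / c * x `^ q = u * (u `^ q * x `^ q / c).
    by field; lra.
  by move: h; rewrite mulrDr mulr1; lra.
have -> : u = 1 + - (1 - u) by lra.
apply: le_trans (expR_ge1Dx _) _; rewrite ler_expR lerN2.
apply: le_trans h'; rewrite ler_pM2r ?powR_gt0// ler_pM2r ?invr_gt0//.
by apply: ge0_ler_powR; rewrite ?nnegrE//; lra.
Qed.

(** With s = sin_pq x <= x, Fpq_le gives
    x = Fpq s <= s (1 + x^q / k) <= s exp (x^q / k). *)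
Lemma sinc_pq_ge r x : 1 < p -> 1 < q -> 2 * r < 1 -> 0 <= x <= 1 -> x `^ q <= r ->
  expR (- ((p * (q + 1) * (1 - 2 * r))^-1 * x `^ q)) <= `|sinc_pq p q x|.
Proof.
move=> p1 q1.
move=> r1 /andP[]; rewrite le_eqVlt => /predU1P[<- _ _|x0 x1 xr].
  rewrite /sinc_pq eqxx normr1 powR0 ?mulr0 ?oppr0 ?expR0// gt_eqF//; lra.
have c0 : 0 < p * (q + 1) by rewrite mulr_gt0//; lra.
have x01 : 0 <= x <= 1 by rewrite ltW.
have [s0 Fx] := Fpq_sin_pq _ p1 q1 x01.
have hs := sin_pq_controlled _ p1 q1 (ltW x0).
rewrite ger0_norm// in hs; have sx := sin_controlled_le _ _ p1 q1 hs.
have [/andP[_ s1] _] := hs.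
rewrite -(ler_pM2r x0) sinc_pq_gt0E// (ger0_norm s0).
set s := sin_pq p q x in Fx s0 sx s1 *.
have sq : s `^ q <= x `^ q by apply: ge0_ler_powR; rewrite ?nnegrE//; lra.
rewrite expRN mulrC ler_pdivrMr ?expR_gt0// -{1}Fx.
apply: le_trans (Fpq_le p q r s p1 q1 r1 _ (le_trans sq xr)) _.
  by rewrite s0.
apply: ler_wpM2l => //; apply: le_trans (expR_ge1Dx _).
rewrite lerD2l -mulrA -invfM mulrC ler_pM2l//.
by rewrite invr_gt0 mulr_gt0//; lra.
Qed.

End sin_pq_bounds.

(** * The integral of exp(- B x^q) *)

Section gamma_integral.
Context {R : realType}.
Notation mu := (@lebesgue_measure R).
Implicit Types q B x t : R.

(** A compact exhaustion of the half-line: on each piece a power function is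
    continuously differentiable up to the endpoints, so substitution applies. *)
Lemma bigcup_itv_invn_n :
  \bigcup_n `[n.+2%:R^-1, n.+2%:R]%classic = `]0, +oo[%classic :> set R.
Proof.
apply/seteqP; split => [x [n _ /=]|x /=]; rewrite !in_itv/= ?andbT.
  by move=> /andP[+ _]; apply: lt_le_trans; rewrite invr_gt0.
move=> x0.
pose n := Num.bound (x + x^-1).
have xn : x + x^-1 < n.+2%:R.
  apply: lt_le_trans (_ : n%:R <= _); last by rewrite ler_nat -addn2 leq_addr.
  by apply: archi_boundP; rewrite addr_ge0 ?invr_ge0// ltW.
have x'0 : 0 < x^-1 by rewrite invr_gt0.
exists n => //=; rewrite in_itv/=; apply/andP; split; last by lra.
by rewrite -[leRHS]invrK lef_pV2 ?posrE//; lra.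
Qed.

(** Applied with V the change of variables on one side of a substitution and
    with V the identity on the other side. *)
Lemma cvg_integral_exhaust (V : R -> R) (f : R -> R) :
  {in `]0, +oo[ &, {homo V : x y / x <= y}} ->
  (forall x, 0 < x -> 0 < V x) ->
  (forall x, 0 < x -> exists2 t, 0 < t & V t = x) ->
  measurable_fun [set: R] f -> (forall x, 0 <= f x) ->
  (\int[mu]_(x in `[V (n.+2%:R^-1)%R, V (n.+2%:R)%R]) (f x)%:E @[n --> \oo] -->
    \int[mu]_(x in `]0%R, +oo[) (f x)%:E)%E.
Proof.
move=> ndV V0 sV mf f0.
have n0 n : (0:R) < n.+2%:R by [].
have i0 n : (0:R) < n.+2%:R^-1 by rewrite invr_gt0.
have -> : `]0, +oo[%classic =
    \bigcup_n `[V n.+2%:R^-1, V n.+2%:R]%classic :> set R.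
  apply/seteqP; split => [x /=|x [n _ /=]]; rewrite !in_itv/= ?andbT; last first.
    by move=> /andP[+ _]; apply: lt_le_trans; exact: V0.
  move=> /sV[t t0 <-]; have : `]0, +oo[%classic t by rewrite /= in_itv/= t0.
  rewrite -bigcup_itv_invn_n => -[n _ /=]; rewrite in_itv/= => /andP[nt tn].
  by exists n => //=; rewrite in_itv/= !ndV// in_itv/= ?andbT.
apply: ge0_nondecreasing_set_cvg_integral => //.
- move=> m n mn; apply/subsetPset; apply: subset_itv; rewrite bnd_simp.
    by apply: ndV; rewrite ?in_itv/= ?andbT// lef_pV2 ?posrE// ler_nat !ltnS.
  by apply: ndV; rewrite ?in_itv/= ?andbT// ler_nat !ltnS.
- by move=> n; apply/measurable_EFinP; exact: measurable_funTS.
- by move=> n x _; rewrite lee_fin.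
Qed.

Lemma measurable_expRN_powR q B :
  measurable_fun [set: R] (fun x : R => expR (- (B * x `^ q))).
Proof.
apply: measurableT_comp => //; apply: measurableT_comp => //.
by apply: measurable_funM => //; exact: measurable_powR.
Qed.

Lemma measurable_Gamma_integrand (a : R) :
  measurable_fun [set: R] (fun t : R => t `^ a * expR (- t)).
Proof.
apply: measurable_funM; first exact: measurable_powR.
by apply: measurableT_comp => //; exact: measurableT_comp.
Qed.

(** The substitution x = V t = (t / B)^(1/q), for which B x^q = t. *)
Lemma integral_subst_powR q B (a b : R) : 0 < q -> 0 < B -> 0 < a <= b ->
  let V := fun t : R => B `^ (- q^-1) * t `^ q^-1 in
  (\int[mu]_(x in `[V a, V b]) (expR (- (B * x `^ q)))%:E =
   (B `^ (- q^-1) * q^-1)%:E *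
     \int[mu]_(t in `[a, b]) (t `^ (q^-1 - 1) * expR (- t))%:E)%E.
Proof.
move=> q0 B0 /andP[a0 ab] V.
have b0 : 0 < b by exact: lt_le_trans ab.
set k := B `^ (- q^-1) in V *.
have k0 : 0 < k by exact: powR_gt0.
have q'0 : 0 < q^-1 by rewrite invr_gt0.
pose W (t : R) := k * (q^-1 * t `^ (q^-1 - 1)).
have dV t : 0 < t -> is_derive t 1 V (W t).
  move=> t0; have dt := is_derive1_powR q^-1 t0.
  have -> : V = k \*: (@powR R ^~ q^-1) by apply/funext.
  by apply: is_derive_eq.
have V'E t : 0 < t -> derive1 V t = W t.
  by move=> t0; have d := dV _ t0; rewrite derive1E derive_val.
have cV' t : 0 < t -> {for t, continuous (derive1 V)}.
  move=> t0; rewrite /prop_for /continuous_at V'E//.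
  have cW : W x @[x --> t] --> W t.
    apply: cvgM; first exact: cvg_cst.
    by apply: cvgM; [exact: cvg_cst|exact: continuous_powR_gt0].
  apply: cvg_trans cW; apply: near_eq_cvg; near=> s.
  by rewrite V'E//; near: s; exact: lt_nbhsr.
have cV t : 0 < t -> {for t, continuous V}.
  move=> t0; apply/differentiable_continuous/derivable1_diffP.
  by have [] := dV _ t0.
rewrite (@integration_by_substitution_increasing R V (fun x : R => expR (- (B * x `^ q))) a b)//.
- rewrite -ge0_integralZl_EFin//; last 3 first.
  + by move=> t _; rewrite lee_fin mulr_ge0 ?powR_ge0 ?expR_ge0.
  + apply/measurable_EFinP/measurable_funTS; exact: measurable_Gamma_integrand.
  + by rewrite mulr_ge0 ?ltW.
  apply: eq_integral => t; rewrite inE/= in_itv/= => /andP[t0 _].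
  have {}t0 : 0 < t by exact: lt_le_trans t0.
  rewrite -EFinM; congr EFin.
  transitivity (expR (- (B * V t `^ q)) * derive1 V t) => //; rewrite V'E// /W.
  have -> : B * V t `^ q = t.
    rewrite /V powRM ?ltW ?powR_gt0// /k -!powRrM mulNr mulVf ?gt_eqF//.
    by rewrite powR_inv1 ?ltW// powRr1 ?ltW// mulrA divff ?gt_eqF// mul1r.
  by ring.
- move=> x y; rewrite !in_itv/= => /andP[ax xb] /andP[ay yb] xy.
  rewrite ltr_pM2l//; apply: gt0_ltr_powR; rewrite ?nnegrE//.
  + by apply: le_trans ax; exact: ltW.
  + by apply: le_trans ay; exact: ltW.
- by move=> x; rewrite in_itv/= => /andP[ax _]; apply: cV'; exact: lt_trans ax.
- by apply/cvg_ex; exists (derive1 V a); apply: cvg_at_right_filter; exact: cV'.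
- by apply/cvg_ex; exists (derive1 V b); apply: cvg_at_left_filter; exact: cV'.
- split.
  + move=> x; rewrite in_itv/= => /andP[ax _].
    by have [] := dV x (lt_trans a0 ax).
  + by apply: cvg_at_right_filter; exact: cV.
  + by apply: cvg_at_left_filter; exact: cV.
- apply: continuous_in_subspaceT => x /[!inE]/=; rewrite in_itv/= => /andP[Vx _].
  have x0 : 0 < x by apply: lt_le_trans Vx; rewrite mulr_gt0// powR_gt0.
  apply: (@continuous_comp _ _ _ (fun x : R => - (B * x `^ q)) (@expR R)); last first.
    exact: continuous_expR.
  by apply: cvgN; apply: cvgM; [exact: cvg_cst|exact: continuous_powR_gt0].
Unshelve. all: by end_near. Qed.

Lemma integral_expRN_powR_Gamma q B : 0 < q -> 0 < B ->
  (\int[mu]_(x in `[0%R, +oo[) (expR (- (B * x `^ q)))%:E =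
   (B `^ (- q^-1) * q^-1)%:E *
     \int[mu]_(t in `]0%R, +oo[) (t `^ (q^-1 - 1) * expR (- t))%:E)%E.
Proof.
move=> q0 B0; have q'0 : 0 < q^-1 by rewrite invr_gt0.
have k0 : 0 < B `^ (- q^-1) by exact: powR_gt0.
pose V := fun t : R => B `^ (- q^-1) * t `^ q^-1.
rewrite -integral_itv_obnd_cbnd; last first.
  by apply/measurable_EFinP/measurable_funTS; exact: measurable_expRN_powR.
apply: (cvg_unique (@ereal_hausdorff R)
  (cvg_integral_exhaust V (fun x => expR (- (B * x `^ q))) _ _ _ _ _)).
- move=> x y; rewrite !in_itv/= !andbT => x0 y0 xy; rewrite ler_pM2l//.
  by apply: ge0_ler_powR => //; rewrite ?nnegrE ltW.
- by move=> x x0; rewrite mulr_gt0// powR_gt0.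
- move=> x x0; exists (B * x `^ q); first by rewrite mulr_gt0// powR_gt0.
  rewrite /V powRM ?powR_ge0 ?ltW// -powRrM mulfV ?gt_eqF// powRr1 ?ltW//.
  by rewrite mulrA powRN mulVf ?mul1r// gt_eqF// powR_gt0.
- exact: measurable_expRN_powR.
- by move=> x; exact: expR_ge0.
have cvgr : (\int[mu]_(t in `[(n.+2%:R^-1)%R, (n.+2%:R)%R])
    (t `^ (q^-1 - 1) * expR (- t))%:E @[n --> \oo] -->
    \int[mu]_(t in `]0%R, +oo[) (t `^ (q^-1 - 1) * expR (- t))%:E)%E.
  apply: (cvg_integral_exhaust id) => //.
  - by move=> x x0; exists x.
  - exact: measurable_Gamma_integrand.
  - by move=> t; rewrite mulr_ge0 ?powR_ge0 ?expR_ge0.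
have := cvgeZl (y := (B `^ (- q^-1) * q^-1)%:E) isT cvgr.
apply: cvg_trans; apply: near_eq_cvg; apply: nearW => n /=; apply/esym.
rewrite integral_subst_powR// invr_gt0 ltr0n/=.
by rewrite (@le_trans _ _ 1)// ?invf_le1 ?ler1n// ltr0n.
Qed.

Lemma expRN_le_oneDsqr x : 0 <= x -> expR (- x) <= 2 * (oneDsqr x)^-1.
Proof.
move=> x0; have h := expR_ge1Dxn 1 x0.
have o0 : 0 < oneDsqr x by rewrite (lt_le_trans ltr01)// oneDsqr_ge1.
rewrite expRN -[2]invrK -invfM lef_pV2 ?posrE ?expR_gt0 ?mulr_gt0//.
apply: le_trans h; rewrite /oneDsqr (_ : 2`!%:R = 2 :> R)//; lra.
Qed.

Lemma integral_oneDsqrZ k : 0 <= k ->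
  (\int[mu]_(x in `[0%R, +oo[) (k * (oneDsqr x)^-1)%:E = (k * (pi / 2))%:E)%E.
Proof.
move=> k0; rewrite EFinM -integral0y_oneDsqr -ge0_integralZl_EFin//.
apply/measurable_EFinP/measurable_funTS; apply: continuous_measurable_fun.
exact: continuous_oneDsqrV.
Qed.

(** As x^q >= x - 1 for x >= 0, the integrand is dominated by exp (1 - x). *)
Lemma expRN_powR_le q x : 1 < q -> 0 <= x ->
  expR (- (1 * x `^ q)) <= expR 1 * 2 * (oneDsqr x)^-1.
Proof.
move=> q1 x0; rewrite -mulrA; apply: le_trans (_ : expR 1 * expR (- x) <= _).
  rewrite -expRD ler_expR mul1r.
  have [x1|x1] := leP x 1; first by have := powR_ge0 x q; lra.
  have := @le1r_powR R x q (ltW x1) (ltW q1); lra.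
by rewrite ler_pM2l ?expR_gt0//; exact: expRN_le_oneDsqr.
Qed.

(** Gamma is a real-valued integral, so it has to be shown that the extended
    integral defining it is finite: this follows from the case B = 1, whose left
    member is finite by expRN_powR_le. *)
Lemma integral_expRN_powR q B : 1 < q -> 0 < B ->
  (\int[mu]_(x in `[0%R, +oo[) (expR (- (B * x `^ q)))%:E =
   (B `^ (- q^-1) * (q^-1 * Gamma q^-1))%:E)%E.
Proof.
move=> q1 B0; have q0 : 0 < q by lra.
have q'0 : 0 < q^-1 by rewrite invr_gt0.
rewrite integral_expRN_powR_Gamma//.
suff h : (\int[mu]_(t in `]0%R, +oo[) (t `^ (q^-1 - 1) * expR (- t))%:E)%E
    \is a fin_num by rewrite -(fineK h) -EFinM mulrA.
have I0 : (0 <= \int[mu]_(t in `]0%R, +oo[) (t `^ (q^-1 - 1) * expR (- t))%:E)%E.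
  by apply: integral_ge0 => t _; rewrite lee_fin mulr_ge0 ?powR_ge0 ?expR_ge0.
rewrite ge0_fin_numE//.
have : (\int[mu]_(x in `[0%R, +oo[) (expR (- (1 * x `^ q)))%:E < +oo)%E.
  apply: le_lt_trans (ltry (expR 1 * 2 * (pi / 2))).
  rewrite -integral_oneDsqrZ; last by rewrite mulr_ge0// expR_ge0.
  apply: ge0_le_integral_nonmeasurable => x; first by rewrite lee_fin expR_ge0.
  by rewrite /= in_itv/= andbT lee_fin => x0; exact: expRN_powR_le.
rewrite integral_expRN_powR_Gamma// powR1 mul1r.
set I := (\int[mu]_(t in _) _)%E in I0 *.
by case: I I0 => [r _ _| _ |//]; rewrite ?ltry// gt0_muley ?lte_fin.
Qed.

End gamma_integral.

(** * Bounds on Ipq for fixed m *)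

Section Ipq_bounds.
Context {R : realType}.
Notation mu := (@lebesgue_measure R).
Implicit Types p q m r x k l : R.

(** The factor m^(1/q) is exactly the Jacobian of x |-> m^(-1/q) x, so the left
    member does not depend on m. *)
Lemma scaled_integral_expRN_powR q m k : 1 < q -> 0 < m -> 0 < k ->
  ((m `^ q^-1)%:E *
    \int[mu]_(x in `[0%R, +oo[) (expR (- (m * k^-1 * x `^ q)))%:E =
   (k `^ q^-1 * (q^-1 * Gamma q^-1))%:E)%E.
Proof.
move=> q1 m0 k0; have k'0 : 0 < k^-1 by rewrite invr_gt0.
rewrite integral_expRN_powR ?mulr_gt0// -EFinM; congr EFin.
rewrite powRM ?ltW// -[in (_ ^-1) `^ _]powR_inv1 ?ltW// -powRrM mulrNN mul1r.
by rewrite powRN !mulrA divff ?mul1r// gt_eqF// powR_gt0.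
Qed.

Lemma Gamma_inv_ge0 q : 1 < q -> 0 <= q^-1 * Gamma q^-1.
Proof.
move=> q1; have := @scaled_integral_expRN_powR q 1 1 q1 ltr01 ltr01.
rewrite !powR1 !mul1r mul1e => h; rewrite -lee_fin -h.
by apply: integral_ge0 => x _; rewrite lee_fin expR_ge0.
Qed.

(** The second term covers the case u <= r: there u^m <= r^(m-2) u^2, and
    u^2 (1 + x^2) <= 2 because both u and u x are at most 1. *)
Lemma sinc_pq_powR_le p q r m x : 1 < p -> 1 < q -> 0 < r -> 2 <= m -> 0 <= x ->
  `|sinc_pq p q x| `^ m <=
    expR (- (m * (p * (q + 1) / r `^ (q + 1))^-1 * x `^ q)) +
    r `^ (m - 2) * 2 * (oneDsqr x)^-1.
Proof.
move=> p1 q1 r0 m2 x0; have o1 := oneDsqr_ge1 x.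
have [ur|ue] := sinc_pq_dichotomy p q r x p1 q1 r0 x0.
- apply: (@le_trans _ _ (r `^ (m - 2) * 2 * (oneDsqr x)^-1)); last first.
    by rewrite lerDr expR_ge0.
  set u := `|_| in ur *; have u0 : 0 <= u by exact: normr_ge0.
  have -> : u `^ m = u `^ (m - 2) * u ^+ 2.
    rewrite -powR_mulrn// -powRD ?subrK//; apply/implyP; lra.
  rewrite -mulrA; apply: ler_pM; rewrite ?powR_ge0 ?sqr_ge0//.
    by apply: ge0_ler_powR; rewrite ?nnegrE//; lra.
  rewrite ler_pdivlMr; last by lra.
  have ux := sinc_pq_mul_le1 p q x p1 q1 x0; have u1 := sinc_pq_le1 p q x p1 q1 x0.
  rewrite /oneDsqr mulrDr mulr1 -exprMn.
  have : u ^+ 2 <= 1 by rewrite expr_le1.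
  have : (u * x) ^+ 2 <= 1 by rewrite expr_le1// mulr_ge0.
  lra.
- apply: (@le_trans _ _ (expR (- (m * (p * (q + 1) / r `^ (q + 1))^-1 * x `^ q)))).
    rewrite invf_div -mulrA mulrC -mulNr expRM.
    by apply: ge0_ler_powR; rewrite ?nnegrE ?expR_ge0//; lra.
  by rewrite lerDl mulr_ge0 ?mulr_ge0 ?powR_ge0// invr_ge0; lra.
Qed.

Lemma Ipq_le p q r m : 1 < p -> 1 < q -> 0 < r -> 2 <= m ->
  (Ipq p q m <= ((p * (q + 1) / r `^ (q + 1)) `^ q^-1 * (q^-1 * Gamma q^-1) +
    m `^ q^-1 * (r `^ (m - 2) * pi))%:E)%E.
Proof.
move=> p1 q1 r0 m2; have m0 : 0 < m by lra.
set k := p * (q + 1) / r `^ (q + 1).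
have k0 : 0 < k by rewrite divr_gt0 ?powR_gt0// mulr_gt0//; lra.
rewrite EFinD -(scaled_integral_expRN_powR _ m)// EFinM -ge0_muleDr; last 2 first.
- by apply: integral_ge0 => x _; rewrite lee_fin expR_ge0.
- by rewrite lee_fin mulr_ge0 ?powR_ge0 ?pi_ge0.
apply: lee_wpmul2l; first by rewrite lee_fin powR_ge0.
have r2 : 0 <= r `^ (m - 2) * 2 by rewrite mulr_ge0 ?powR_ge0.
have -> : r `^ (m - 2) * pi = r `^ (m - 2) * 2 * (pi / 2) by field.
have o0 x : 0 <= (oneDsqr x)^-1.
  by rewrite invr_ge0 (le_trans ler01)// oneDsqr_ge1.
rewrite -integral_oneDsqrZ// -ge0_integralD//; last 3 first.
- by apply/measurable_EFinP/measurable_funTS; exact: measurable_expRN_powR.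
- by move=> x _; rewrite lee_fin mulr_ge0.
- apply/measurable_EFinP/measurable_funTS/measurable_funM => //.
  by apply: continuous_measurable_fun; exact: continuous_oneDsqrV.
apply: ge0_le_integral_nonmeasurable => x; first by rewrite lee_fin powR_ge0.
rewrite /= in_itv/= andbT => x0; rewrite -EFinD lee_fin.
exact: sinc_pq_powR_le.
Qed.

(** The lower bound on u is only available when x^q <= r.  When x^q > r the
    left member is itself exponentially small in m, relative to the integrable
    function exp (- x^q / k). *)
Lemma sinc_pq_powR_ge p q r m x : 1 < p -> 1 < q -> 0 < r -> 2 * r < 1 ->
  1 <= m -> 0 <= x ->
  let k := p * (q + 1) * (1 - 2 * r) in
  expR (- (m * k^-1 * x `^ q)) <= `|sinc_pq p q x| `^ m +
    expR (- ((m - 1) * (k^-1 * r))) * expR (- (k^-1 * x `^ q)).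
Proof.
move=> p1 q1 r0 r1 m1 x0 /=; set k := p * (q + 1) * (1 - 2 * r).
have k0 : 0 < k by rewrite !mulr_gt0//; lra.
have [xr|rx] := leP (x `^ q) r.
- have x1 : x <= 1.
    rewrite leNgt; apply/negP => x1.
    have := @le1r_powR R x q (ltW x1) (ltW q1); lra.
  apply: (@le_trans _ _ (`|sinc_pq p q x| `^ m)); last first.
    by rewrite lerDl mulr_ge0 ?expR_ge0.
  rewrite -mulrA mulrC -mulNr expRM.
  apply: ge0_ler_powR; rewrite ?nnegrE ?expR_ge0//; first by lra.
  by apply: sinc_pq_ge => //; rewrite x0.
- apply: (@le_trans _ _ (expR (- ((m - 1) * (k^-1 * r))) * expR (- (k^-1 * x `^ q)))).
    rewrite -expRD ler_expR -opprD lerN2.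
    have -> : m * k^-1 * x `^ q =
      (m - 1) * (k^-1 * x `^ q) + k^-1 * x `^ q by ring.
    rewrite lerD2r; apply: ler_wpM2l; first by lra.
    by rewrite ler_wpM2l// ?invr_ge0 ltW.
  by rewrite lerDr powR_ge0.
Qed.

Lemma Ipq_ge p q r m : 1 < p -> 1 < q -> 0 < r -> 2 * r < 1 -> 1 <= m ->
  let k := p * (q + 1) * (1 - 2 * r) in
  let L := k `^ q^-1 * (q^-1 * Gamma q^-1) in
  ((L - m `^ q^-1 * (expR (- ((m - 1) * (k^-1 * r))) * L))%:E <= Ipq p q m)%E.
Proof.
move=> p1 q1 r0 r1 m1 /=; set k := p * (q + 1) * (1 - 2 * r).
set L := k `^ q^-1 * _; have m0 : 0 < m by lra.
have k0 : 0 < k by rewrite !mulr_gt0//; lra.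
have LE : (\int[mu]_(x in `[0%R, +oo[) (expR (- (k^-1 * x `^ q)))%:E = L%:E)%E.
  by rewrite -(scaled_integral_expRN_powR _ 1)// powR1 mul1e mul1r.
set E := expR _.
(* The difference of the two exponentials, cut at 0, is a measurable minorant
   of u^m; additivity of the integral is applied to it rather than to u^m. *)
pose g x := Num.max 0 (expR (- (m * k^-1 * x `^ q)) - E * expR (- (k^-1 * x `^ q))).
have mexp b : measurable_fun [set: R] (fun x : R => expR (- (b * x `^ q))).
  exact: measurable_expRN_powR.
have mE : measurable_fun [set: R] (fun x : R => E * expR (- (k^-1 * x `^ q))).
  by apply: measurable_funM => //; exact: mexp.
have mg : measurable_fun [set: R] g.
  by apply: measurable_maxr => //; apply: measurable_funB => //; exact: mexp.
have g0 x : 0 <= g x by rewrite le_max lexx.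
have I1 : (\int[mu]_(x in `[0%R, +oo[) (expR (- (m * k^-1 * x `^ q)))%:E <=
    \int[mu]_(x in `[0%R, +oo[) (`|sinc_pq p q x| `^ m)%:E + (E * L)%:E)%E.
  apply: (@le_trans _ _ (\int[mu]_(x in `[0%R, +oo[) (g x)%:E + (E * L)%:E)%E).
    rewrite EFinM -LE -ge0_integralZl_EFin ?expR_ge0//; last first.
      by apply/measurable_EFinP/measurable_funTS; exact: mexp.
    rewrite -ge0_integralD//; last 4 first.
    - by move=> x _; rewrite lee_fin.
    - by apply/measurable_EFinP/measurable_funTS.
    - by move=> x _; rewrite lee_fin mulr_ge0 ?expR_ge0.
    - by apply/measurable_EFinP/measurable_funTS; exact: mE.
    apply: ge0_le_integral_nonmeasurable => x; first by rewrite lee_fin expR_ge0.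
    by move=> _; rewrite -EFinM -EFinD lee_fin -lerBlDr le_max lexx orbT.
  apply: leeD2r; apply: ge0_le_integral_nonmeasurable => x.
    by rewrite lee_fin.
  rewrite /= in_itv/= andbT lee_fin => x0; rewrite ge_max powR_ge0/= lerBlDr.
  exact: sinc_pq_powR_ge.
rewrite EFinB leeBlDr// -[X in (X%:E <= _)%E]/L.
rewrite -(scaled_integral_expRN_powR q m k)// EFinM -ge0_muleDr; last 2 first.
- by apply: integral_ge0 => x _; rewrite lee_fin powR_ge0.
- rewrite lee_fin mulr_ge0 ?expR_ge0// mulr_ge0 ?powR_ge0//.
  exact: Gamma_inv_ge0.
by apply: lee_wpmul2l; rewrite ?lee_fin ?powR_ge0.
Qed.

End Ipq_bounds.

(** * Passage to the limit *)

Section limit.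
Context {R : realType}.
Implicit Types p q m b e C l : R.

(** All error terms have this shape; it is O(1 / m), by m^(1/q) <= m and
    exp y >= y^2 / 2. *)
Lemma near_powR_expRN_le q b C e : 1 < q -> 0 < b -> 0 < e ->
  \forall m \near +oo, m `^ q^-1 * (expR (- (b * m)) * C) <= e.
Proof.
move=> q1 b0 e0; near=> m.
have m1 : 1 <= m by near: m; apply: nbhs_pinfty_ge; exact: num_real.
have mM : 2 / b ^+ 2 * `|C| / e <= m.
  by near: m; apply: nbhs_pinfty_ge; exact: num_real.
have m0 : 0 < m by lra.
have b20 : 0 < b ^+ 2 by rewrite exprn_gt0.
have mq : m `^ q^-1 <= m by apply: ler1_powR => //; rewrite invf_le1//; lra.
have em : expR (- (b * m)) <= 2 / (b * m) ^+ 2.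
  rewrite expRN -[2]invrK -invfM lef_pV2 ?posrE ?expR_gt0//; last first.
    by rewrite mulr_gt0 ?invr_gt0// exprn_gt0// mulr_gt0.
  have := @expR_ge1Dxn R (b * m) 1 (ltW (mulr_gt0 b0 m0)).
  by rewrite (_ : 2`!%:R = 2 :> R)//; lra.
apply: (@le_trans _ _ (m * (2 / (b * m) ^+ 2 * `|C|))).
  apply: (@le_trans _ _ (m `^ q^-1 * (expR (- (b * m)) * `|C|))).
    by rewrite ler_wpM2l ?powR_ge0// ler_wpM2l ?expR_ge0// ler_norm.
  apply: ler_pM => //; rewrite ?powR_ge0// ?mulr_ge0 ?expR_ge0//.
  by rewrite ler_wpM2r.
have -> : m * (2 / (b * m) ^+ 2 * `|C|) = 2 / b ^+ 2 * `|C| / m.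
  by field; lra.
by rewrite ler_pdivrMr// [e * m]mulrC -ler_pdivrMr.
Unshelve. all: by end_near. Qed.

(** Ipq_le with r^(q+1) = l^q, so that (c / r^(q+1))^(1/q) = c^(1/q) / l. *)
Lemma near_Ipq_le p q l e : 1 < p -> 1 < q -> 0 < l < 1 -> 0 < e ->
  \forall m \near +oo, (Ipq p q m <=
    (l^-1 * (q^-1 * Gamma q^-1 * (p * (q + 1)) `^ q^-1) + e)%:E)%E.
Proof.
move=> p1 q1 /andP[l0 l1] e0.
have c0 : 0 < p * (q + 1) by rewrite mulr_gt0//; lra.
pose r := l `^ (q / (q + 1)).
have r0 : 0 < r by exact: powR_gt0.
have rl : r `^ (q + 1) = l `^ q by rewrite /r -powRrM divfK// gt_eqF//; lra.
have lnr : 0 < - ln r.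
  rewrite oppr_gt0 ln_powR pmulr_rlt0; first by apply: ln_lt0; rewrite l0.
  by rewrite divr_gt0//; lra.
near=> m; have m2 : 2 <= m by near: m; apply: nbhs_pinfty_ge; exact: num_real.
apply: le_trans (Ipq_le p q r m p1 q1 r0 m2) _; rewrite lee_fin rl.
apply: lerD.
  rewrite powRM ?powR_ge0 ?invr_ge0 ?powR_ge0 ?(ltW c0)//.
  rewrite -powRN -powRrM mulNr mulfV; last by rewrite gt_eqF//; lra.
  rewrite powR_inv1 ?(ltW l0)//.
  by rewrite le_eqVlt; apply/orP; left; apply/eqP; ring.
rewrite (_ : r `^ (m - 2) * pi = expR (- (- ln r * m)) * (expR (2 * - ln r) * pi)).
  by near: m; exact: near_powR_expRN_le.
by rewrite mulrA -expRD {1}/powR gt_eqF//; congr (expR _ * _); ring.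
Unshelve. all: by end_near. Qed.

(** Ipq_ge with 1 - 2 r = l^q, so that (c (1 - 2 r))^(1/q) = l c^(1/q). *)
Lemma near_Ipq_ge p q l e : 1 < p -> 1 < q -> 0 < l < 1 -> 0 < e ->
  \forall m \near +oo,
    ((l * (q^-1 * Gamma q^-1 * (p * (q + 1)) `^ q^-1) - e)%:E <= Ipq p q m)%E.
Proof.
move=> p1 q1 /andP[l0 l1] e0.
have c0 : 0 < p * (q + 1) by rewrite mulr_gt0//; lra.
have lq0 : 0 < l `^ q by exact: powR_gt0.
have lq1 : l `^ q < 1.
  have : l `^ q < (1 : R) `^ q.
    by apply: gt0_ltr_powR; rewrite ?nnegrE//; lra.
  by rewrite powR1.
pose r := (1 - l `^ q) / 2.
have r0 : 0 < r by rewrite /r; lra.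
have r1 : 2 * r < 1 by rewrite /r; lra.
have rl : 1 - 2 * r = l `^ q by rewrite /r; lra.
pose k := p * (q + 1) * l `^ q; pose L := k `^ q^-1 * (q^-1 * Gamma q^-1).
pose b := k^-1 * r.
have b0 : 0 < b by rewrite mulr_gt0// invr_gt0 mulr_gt0.
near=> m; have m1 : 1 <= m by near: m; apply: nbhs_pinfty_ge; exact: num_real.
apply: le_trans (Ipq_ge p q r m p1 q1 r0 r1 m1); rewrite lee_fin rl.
rewrite -/k -/L -/b; apply: lerB.
  rewrite /L /k (powRM _ (ltW c0) (ltW lq0)) -powRrM mulfV; last first.
    by rewrite gt_eqF//; lra.
  rewrite powRr1 ?(ltW l0)//.
  by rewrite le_eqVlt; apply/orP; left; apply/eqP; ring.
rewrite (_ : expR (- ((m - 1) * b)) * L = expR (- (b * m)) * (expR b * L)).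
  by near: m; exact: near_powR_expRN_le.
by rewrite mulrA -expRD; congr (expR _ * _); ring.
Unshelve. all: by end_near. Qed.

End limit.

Theorem corollary2p1 (R : realType) (p q : R) (hp : 1 < p) (hq : 1 < q) :
  Ipq p q m @[m --> +oo] -->
    (q^-1 * Gamma q^-1 * (p * (q + 1)) `^ q^-1)%:E.
Proof.
set L := _ * _ `^ _.
have L0 : 0 <= L by rewrite mulr_ge0 ?powR_ge0// Gamma_inv_ge0.
have near_L e : 0 < e ->
    \forall m \near +oo, ((L - e)%:E <= Ipq p q m <= (L + e)%:E)%E.
  move=> e0; pose d := e / 2; have d0 : 0 < d by rewrite /d; lra.
  (* L + 1 rather than L, so that l > 0 even if L = 0. *)
  pose l := (L + 1) / (L + 1 + d).
  have l01 : 0 < l < 1.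
    by rewrite divr_gt0/= ?ltr_pdivrMr; lra.
  have lL : l^-1 * L <= L + d.
    rewrite /l invf_div mulrC mulrA ler_pdivrMr; last by lra.
    nra.
  have Ll : L - d <= l * L.
    by rewrite /l mulrAC ler_pdivlMr; [nra|lra].
  near=> m; apply/andP; split.
  - apply: (@le_trans _ _ (l * L - d)%:E).
      by rewrite lee_fin /d in Ll *; lra.
    by near: m; exact: near_Ipq_ge.
  - apply: (@le_trans _ _ (l^-1 * L + d)%:E).
      by near: m; exact: near_Ipq_le.
    by rewrite lee_fin /d in lL *; lra.
have fin m e : ((L - e)%:E <= Ipq p q m <= (L + e)%:E)%E -> Ipq p q m \is a fin_num.
  move=> /andP[lo up]; rewrite fin_numE; apply/andP; split; apply/eqP => h.
    by rewrite h in lo.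
  by rewrite h in up.
apply/fine_cvgP; split.
  by near=> m; apply: (fin m 1); near: m; exact: near_L.
apply/cvgrPdist_le => e e0; near=> m.
have h : ((L - e)%:E <= Ipq p q m <= (L + e)%:E)%E by near: m; exact: near_L.
have := h; rewrite -(fineK (fin _ _ h)) !lee_fin => hL.
rewrite /= ler_norml; lra.
Unshelve. all: by end_near. Qed.
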